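(* Let $\mathcal{H}=\mathcal{V}\oplus\mathcal{W}^{\perp}$. Let $(\mathbf{W},\mathbf{w})$ be a fusion frame for $\mathcal{W}$, $(\mathbf{V},\mathbf{v})$ a fusion frame for $\mathcal{V}$ and $Q\in B(\mathcal{K}_{\mathbf{W}},\mathcal{K}_{\mathbf{V}})$ such that $(\mathbf{V},\mathbf{v})$ is an $\epsilon$-approximate oblique $Q$-dual fusion frame of $(\mathbf{W},\mathbf{w})$ on $\mathcal{V}$ with $\epsilon<1$. Let $A=\left((T_{\mathbf{V},\mathbf{v}}QT_{\mathbf{W},\mathbf{w}}^{*})_{|\mathcal{V}}\right)^{-1}:\mathcal{V}\to\mathcal{V}$ (the operator $(T_{\mathbf{V},\mathbf{v}}QT_{\mathbf{W},\mathbf{w}}^{*})_{|\mathcal{V}}$ from $\mathcal{V}$ to $\mathcal{V}$ is invertible since $\epsilon<1$) and let $\widetilde{\mathbf{v}}$ be a family of weights. If $(A\mathbf{V},\widetilde{\mathbf{v}})$ is a fusion Bessel sequence for $\mathcal{V}$ and $Q_{AT_{\mathbf{V},\mathbf{v}},\widetilde{\mathbf{v}}}$ is a bounded operator, then $(A\mathbf{V},\widetilde{\mathbf{v}})$ is an oblique $Q_{AT_{\mathbf{V},\mathbf{v}},\widetilde{\mathbf{v}}}Q$-dual fusion frame of $(\mathbf{W},\mathbf{w})$ on $\mathcal{V}$.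
   Context: $\mathcal{H}$ is a separable Hilbert space over $\mathbb{R}$ or $\mathbb{C}$, $\mathcal{V},\mathcal{W}$ are closed subspaces of $\mathcal{H}$, $I$ is a countable index set, and $B(\cdot,\cdot)$ denotes bounded linear operators. $\mathcal{H}=\mathcal{V}\oplus\mathcal{W}^{\perp}$ means a direct (not necessarily orthogonal) sum; $\pi_{\mathcal{V},\mathcal{W}^{\perp}}$ is the oblique projection with image $\mathcal{V}$ and kernel $\mathcal{W}^{\perp}$. Families of subspaces: $\mathbf{W}=\{W_i\}_{i\in I}$ is a family of closed subspaces of $\mathcal{W}$ and $\mathbf{w}=\{w_i\}_{i\in I}$ a family of weights, i.e. $w_i>0$ for all $i$ (all families of weights are assumed to be in $\ell^\infty(I)$); $(\mathbf{W},\mathbf{w})$ stands for $\{(W_i,w_i)\}_{i\in I}$. $\mathcal{K}_{\mathbf{W}}=\oplus_{i\in I}W_i$ is the Hilbert ($\ell^2$) direct sum. $(\mathbf{W},\mathbf{w})$ is a fusion frame for $\mathcal{W}$ if there are $0<\alpha\le\beta<\infty$ with $\alpha\|f\|^2\le\sum_{i\in I}w_i^2\|\pi_{W_i}f\|^2\le\beta\|f\|^2$ for all $f\in\mathcal{W}$ ($\pi_{W_i}$ the orthogonal projection onto $W_i$); it is a fusion Bessel sequence for $\mathcal{W}$ if only the upper inequality is required. In that case the synthesis operator $T_{\mathbf{W},\mathbf{w}}:\mathcal{K}_{\mathbf{W}}\to\mathcal{H}$, $(f_i)_{i}\mapsto\sum_i w_if_i$, is bounded, with adjoint $T_{\mathbf{W},\mathbf{w}}^{*}f=(w_i\pi_{W_i}f)_{i}$.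 The same notation is used for $(\mathbf{V},\mathbf{v})$ with closed subspaces $V_i$ of $\mathcal{V}$. For an operator $A$, $A\mathbf{V}=\{AV_i\}_{i\in I}$. For $\epsilon\ge0$ and $Q\in B(\mathcal{K}_{\mathbf{W}},\mathcal{K}_{\mathbf{V}})$, a fusion frame $(\mathbf{V},\mathbf{v})$ for $\mathcal{V}$ is an $\epsilon$-approximate oblique $Q$-dual fusion frame of the fusion frame $(\mathbf{W},\mathbf{w})$ for $\mathcal{W}$ on $\mathcal{V}$ if $\|T_{\mathbf{V},\mathbf{v}}QT_{\mathbf{W},\mathbf{w}}^{*}-\pi_{\mathcal{V},\mathcal{W}^{\perp}}\|\le\epsilon$; for $\epsilon=0$ it is called an oblique $Q$-dual fusion frame. For $j\in I$, $M_j$ denotes the operator on a space $\mathcal{K}_{\mathbf{U}}$ which keeps the $j$-th component and replaces all the others by $0$. For a bounded operator $L:\mathcal{K}_{\mathbf{U}}\to\mathcal{V}$ and weights $\mathbf{u}=\{u_i\}$, $Q_{L,\mathbf{u}}$ is the map on $\mathcal{K}_{\mathbf{U}}$ given by $Q_{L,\mathbf{u}}(f_j)_{j\in I}=\left(\frac{1}{u_i}LM_i(f_j)_{j\in I}\right)_{i\in I}$, with values in $\oplus_{i\in I}LM_i\mathcal{K}_{\mathbf{U}}$. In particular $Q_{AT_{\mathbf{V},\mathbf{v}},\widetilde{\mathbf{v}}}:\mathcal{K}_{\mathbf{V}}\to\mathcal{K}_{A\mathbf{V}}$, $(f_i)_i\mapsto\left(\frac{v_i}{\widetilde v_i}Af_i\right)_i$.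 *)

(* Defs.v *)
From mathcomp Require Import all_boot all_order all_algebra.
From mathcomp Require Import sesquilinear.
From mathcomp Require Import all_classical all_reals all_analysis.
From mathcomp Require Import complex.
From mathcomp.analysis.showcase Require summability.

Set Implicit Arguments.
Unset Strict Implicit.
Unset Printing Implicit Defensive.

Import Order.TTheory GRing.Theory Num.Theory.
Import numFieldNormedType.Exports.

Local Open Scope classical_set_scope.
Local Open Scope ring_scope.

(** The scalar field is either [R] or [R[i]]; norms of vectors are scalars in
    MathComp-Analysis, hence the projection [scalar_re] in [hnorm] below. *)

Inductive scalar_kind := RealScalars | ComplexScalars.

Definition scalars (R : realType) (s : scalar_kind) : numFieldType :=
  match s with RealScalars => R | ComplexScalars => R[i] end.

Definition scalar_conj (R : realType) (s : scalar_kind) :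
    scalars R s -> scalars R s :=
  match s with RealScalars => id | ComplexScalars => @conjc R end.

Definition scalar_re (R : realType) (s : scalar_kind) : scalars R s -> R :=
  match s with RealScalars => id | ComplexScalars => @complex.Re R end.

Definition of_real (R : realType) (s : scalar_kind) : R -> scalars R s :=
  match s with RealScalars => id | ComplexScalars => fun x => (x%:C)%C end.

Definition separable_space (T : topologicalType) :=
  exists2 D : set T, countable D & dense D.

(** An operator between subspaces [X] and [Y] is represented by a total
    function whose values outside of [X] are irrelevant. *)

Record bounded_op (R : realType) (K : numFieldType) (E F : lmodType K)
    (nE : E -> R) (nF : F -> R) (X : set E) (Y : set F) (T : E -> F) : Prop :=
  BoundedOp {
    bounded_op_maps : forall x, X x -> Y (T x) ;
    bounded_op_linear : forall (a : K) x y, X x -> X y ->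
      T (a *: x + y) = a *: T x + T y ;
    bounded_op_bound : exists C : R, forall x, X x -> nF (T x) <= C * nE x }.

Definition inverse_on (E : Type) (X : set E) (T A : E -> E) :=
  [/\ forall x, X x -> X (T x),
      forall x, X x -> X (A x),
      forall x, X x -> A (T x) = x &
      forall x, X x -> T (A x) = x].

Section Hilbert.
Context (R : realType) (s : scalar_kind).
Local Notation K := (scalars R s).
Context (H : completeNormedModType K) (dot : {dot H for @scalar_conj R s}).

Definition hnorm (x : H) : R := scalar_re `|x|.

Definition closed_subspace (U : set H) :=
  closed U /\ GRing.submod_closed (mem U).

Definition orthocomp (U : set H) : set H :=
  [set x | forall y, U y -> dot x y = 0].

Definition direct_sum (U V : set H) :=
  U `&` V = [set 0] /\ forall x, exists y z, [/\ U y, V z & x = y + z].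

(** The oblique projection with image [U] and kernel [V]; only meaningful when
    [direct_sum U V] holds, in which case the defining set is a singleton. *)
Definition proj (U V : set H) (x : H) : H := xget 0 [set y | U y /\ V (x - y)].

Definition orthoproj (U : set H) : H -> H := proj U (orthocomp U).

Definition opnorm (T : H -> H) : \bar R :=
  ereal_sup [set (hnorm (T x))%:E | x in [set x | hnorm x <= 1]].

Section Families.
Context (I : countType).
Implicit Types (V W : set H) (Ui : I -> set H) (u : I -> R) (f g : I -> H).

(** Elements of the Hilbert direct sum of [Ui] are families in [I -> H] lying
    in the set [hsum Ui]; [hsum_norm] and [hsum_dot] are meaningful there only.
    [summability.sum] is the limit along the net of finite subsets of [I]. *)

Definition sqsum f : \bar R := \esum_(i in [set: I]) (hnorm (f i) ^+ 2)%:E.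

Definition hsum Ui : set (I -> H) :=
  [set f | (forall i, Ui i (f i)) /\ (sqsum f < +oo)%E].

Definition hsum_norm f : R := Num.sqrt (fine (sqsum f)).

Definition hsum_dot f g : K :=
  summability.sum (fun i => dot (f i) (g i) : K^o).

Definition weights u :=
  (forall i, 0 < u i) /\ exists M : R, forall i, u i <= M.

Definition subspace_family V Ui :=
  forall i, closed_subspace (Ui i) /\ Ui i `<=` V.

Definition frame_sum Ui u (x : H) : \bar R :=
  \esum_(i in [set: I]) (u i ^+ 2 * hnorm (orthoproj (Ui i) x) ^+ 2)%:E.

Definition fusion_bessel V Ui u :=
  [/\ subspace_family V Ui, weights u &
      exists2 b : R, 0 < b &
        forall x, V x -> (frame_sum Ui u x <= (b * hnorm x ^+ 2)%:E)%E].

Definition fusion_frame V Ui u :=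
  [/\ subspace_family V Ui, weights u &
      exists a b : R, [/\ 0 < a, a <= b &
        forall x, V x ->
          ((a * hnorm x ^+ 2)%:E <= frame_sum Ui u x)%E /\
          (frame_sum Ui u x <= (b * hnorm x ^+ 2)%:E)%E]].

(** [synthesis] acts on [hsum Ui], and [analysis Ui u] is the adjoint of this
    restriction, which for Bessel sequences is
    [x |-> (of_real s (u i) *: orthoproj (Ui i) x)_i]. *)

Definition synthesis u f : H :=
  summability.sum (fun i => of_real s (u i) *: f i).

Definition analysis Ui u (x : H) : I -> H :=
  xget 0 [set g | hsum Ui g /\
    forall f, hsum Ui f -> dot (synthesis u f) x = hsum_dot f g].

(** For [Q] in B(K_Wi, K_Vi), the operator T_{Vi,v} Q T_{Wi,w}^*. *)
Definition mixed_op Wi (w v : I -> R) (Q : (I -> H) -> I -> H) (x : H) : H :=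
  synthesis v (Q (analysis Wi w x)).

Definition hsum_bounded_op Wi Vi (Q : (I -> H) -> I -> H) :=
  bounded_op hsum_norm hsum_norm (hsum Wi) (hsum Vi) Q.

Definition approx_oblique_dual (eps : R) (Q : (I -> H) -> I -> H)
    V Vi (v : I -> R) W Wi (w : I -> R) :=
  [/\ 0 <= eps, fusion_frame W Wi w, fusion_frame V Vi v,
      hsum_bounded_op Wi Vi Q &
      (opnorm (fun x => mixed_op Wi w v Q x - proj V (orthocomp W) x)%R
         <= eps%:E)%E].

Definition oblique_dual := approx_oblique_dual 0.

Definition component (j : I) f : I -> H := fun i => if i == j then f i else 0.

Definition component_op (L : (I -> H) -> H) u f : I -> H :=
  fun i => (of_real s (u i))^-1 *: L (component i f).

End Families.
End Hilbert.

(* Main.v *)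
Require Import Defs.
From mathcomp Require Import all_boot all_order all_algebra.
From mathcomp Require Import sesquilinear.
From mathcomp Require Import all_classical all_reals all_analysis.
From mathcomp Require Import finmap complex ring lra.
From mathcomp.analysis.showcase Require summability.

Set Implicit Arguments.
Unset Strict Implicit.
Unset Printing Implicit Defensive.

Import Order.TTheory GRing.Theory Num.Theory.
Import numFieldNormedType.Exports.

Local Open Scope classical_set_scope.
Local Open Scope ring_scope.

(** The operator [L = T_V Q T_W^*] is [eps]-close to the oblique projection
    [P] onto [V] along the orthogonal complement of [W].  On [V] the projection
    is the identity, so [L] restricted to [V] is a perturbation of the identity
    by an operator of norm [eps < 1], hence invertible with a bounded inverse
    [A] ([near_identity_inverse]).  Moreover [T_W^*] vanishes on the orthogonal
    complement of [W], so [L = L P] ([mixed_op_proj]) and therefore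
    [A L = A L P = P] on the whole space.

    Since [A] is bounded and linear on [V], it can be moved inside the
    synthesis series: the new family satisfies
    [T_(AV) (Q_A f) = sum_i A (v_i f_i) = A (T_V f)] ([synthesis_image]), the
    new weights cancelling.  Composing with [Q T_W^*] gives
    [T_(AV) Q_A Q T_W^* = A L = P], which is exact duality.

    It remains to see that the Bessel sequence [(AV, vt)] is a frame.  This
    holds for every Bessel sequence having a dual ([dual_bessel_frame]): for
    [x] in [V] and [g = Q_A Q T_W^* x],
    [|x|^2 = <T g, x> = <g, T^* x> <= |g| |T^* x| <= C |x| |T^* x|],
    and [|T^* x|^2] is the frame sum at [x].

    The operators are given by limits and choices, so each must first be shown
    to be what it is named after.  The synthesis series of a Bessel sequence
    converges unconditionally ([synthesis_cvg]), because its sums over finite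
    sets of indices avoiding a large finite set are small.  The adjoint of
    synthesis is the family of weighted orthogonal projections ([analysisE]),
    which rests on the existence of orthogonal projections onto closed subspaces
    ([closest_point], by the parallelogram law).

    Real and complex scalars are treated together by working with
    the real part [rdot] of the inner product and the real-valued norm: on a
    subspace they determine orthogonality over the scalars ([dot_eq0]). *)

(** * The scalar field *)

Section Scalars.
Context (R : realType) (s : scalar_kind).
Local Notation K := (scalars R s).
Implicit Types (a b : R) (z : K).

Lemma of_realK : cancel (@of_real R s) (@scalar_re R s).
Proof. by case: s. Qed.

Lemma of_realD a b : of_real s (a + b) = of_real s a + of_real s b.
Proof. by case: s => //=; rewrite rmorphD. Qed.

Lemma of_realM a b : of_real s (a * b) = of_real s a * of_real s b.
Proof. by case: s => //=; rewrite rmorphM. Qed.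

Lemma of_real0 : of_real s 0 = 0 :> K.
Proof. by case: s. Qed.

Lemma of_real1 : of_real s 1 = 1 :> K.
Proof. by case: s. Qed.

Lemma of_realN a : of_real s (- a) = - of_real s a.
Proof. by case: s => //=; rewrite rmorphN. Qed.

Lemma of_realX2 a : of_real s (a ^+ 2) = of_real s a ^+ 2.
Proof. by rewrite !expr2 of_realM. Qed.

Lemma ler_of_real a b : (of_real s a <= of_real s b) = (a <= b).
Proof. by case: s => //=; rewrite lecR. Qed.

Lemma ltr_of_real a b : (of_real s a < of_real s b) = (a < b).
Proof. by case: s => //=; rewrite ltcR. Qed.

Lemma conj_of_real a : scalar_conj (of_real s a) = of_real s a.
Proof. by case: s => //=; rewrite oppr0. Qed.

Lemma of_realV a : of_real s a^-1 = (of_real s a)^-1.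
Proof. by case: s => //=; rewrite fmorphV. Qed.

Lemma scalar_reD z z' : scalar_re (z + z') = scalar_re z + scalar_re z'.
Proof. by case: s z z' => //= -[? ?] [? ?]. Qed.

Lemma scalar_reM a z : scalar_re (of_real s a * z) = a * scalar_re z.
Proof. by case: s z => //= -[? ?] /=; rewrite mul0r subr0. Qed.

Lemma scalar_re_conj z : scalar_re (scalar_conj z) = scalar_re z.
Proof. by case: s z => //= -[]. Qed.

Lemma norm_scalar_conj z : `|scalar_conj z| = `|z|.
Proof. by case: s z => //= z; rewrite normcJ. Qed.

Lemma scalar_re_conjM z : scalar_re (scalar_conj z * z) = scalar_re `|z| ^+ 2.
Proof.
case: s z => /= z; first by rewrite real_normK ?num_real// expr2.
rewrite mulrC -sqr_normc normc_def; case: z => x y /=.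
by rewrite expr2 /= mulr0 subr0.
Qed.

Lemma scalar_re_norm a : scalar_re `|of_real s a| = `|a|.
Proof.
by case: s => //; rewrite /of_real normc_def /= expr0n addr0 sqrtr_sqr.
Qed.

Lemma ge0_of_real z : 0 <= z -> z = of_real s (scalar_re z).
Proof. by case: s z => //= -[x y]; rewrite lecE /= => /andP[/eqP -> _]. Qed.

End Scalars.

(** * The real inner product and convergence in norm *)

(** Common source of the variational argument and of the Cauchy-Schwarz
    inequalities below: evaluate at the minimum [t = b / c]; when [c = 0] the
    polynomial is affine, so its slope must vanish. *)
Lemma quadratic_discriminant (R : realFieldType) (a b c : R) :
  0 <= a -> 0 <= c -> (forall t, 0 <= a - 2 * t * b + t ^+ 2 * c) ->
  b ^+ 2 <= a * c.
Proof.
move=> a0 c0 h; have [c_eq0|cn0] := eqVneq c 0.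
  have [->|bn0] := eqVneq b 0; first by rewrite expr0n mulr_ge0.
  (* here the polynomial would take the value -1 *)
  have := h ((a + 1) / (2 * b)); rewrite c_eq0 mulr0 addr0.
  suff -> : a - 2 * ((a + 1) / (2 * b)) * b = -1 by lra.
  by field.
have cp : 0 < c by rewrite lt_neqAle eq_sym cn0.
have := h (b / c); rewrite -(ler_pM2r cp) mul0r.
suff -> : (a - 2 * (b / c) * b + (b / c) ^+ 2 * c) * c = a * c - b ^+ 2.
  by rewrite subr_ge0.
by field.
Qed.

Section Inner.
Context (R : realType) (s : scalar_kind).
Local Notation K := (scalars R s).
Context (H : completeNormedModType K) (dot : {dot H for @scalar_conj R s}).
Hypothesis dot_norm : forall x : H, dot x x = `|x| ^+ 2.
Implicit Types (x y z : H) (a b : R).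

Local Notation N := (@hnorm R s H).
Local Notation "a %:K" := (of_real s a) (at level 2, format "a %:K").

Lemma normr_hnorm x : `|x| = (N x)%:K.
Proof. exact/ge0_of_real/normr_ge0. Qed.

Lemma hnorm_ge0 x : 0 <= N x.
Proof. by rewrite -(ler_of_real s) of_real0 -normr_hnorm. Qed.

Lemma hnorm_eq0 x : (N x == 0) = (x == 0).
Proof.
rewrite -(normr_eq0 x) normr_hnorm; apply/eqP/eqP => [->|].
  by rewrite of_real0.
by rewrite -(of_real0 R s) => /(can_inj (@of_realK R s)).
Qed.

Lemma ler_hnormD x y : N (x + y) <= N x + N y.
Proof. by rewrite -(ler_of_real s) of_realD -!normr_hnorm ler_normD. Qed.

Lemma hnormZ (c : K) x : N (c *: x) = scalar_re `|c| * N x.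
Proof.
by rewrite /hnorm normrZ (ge0_of_real (normr_ge0 c)) scalar_reM of_realK.
Qed.

Lemma hnormZr a x : N (a%:K *: x) = `|a| * N x.
Proof.
by rewrite hnormZ scalar_re_norm.
Qed.

Lemma hnormN x : N (- x) = N x.
Proof. by rewrite /hnorm normrN. Qed.

Lemma hnormB x y : N (x - y) = N (y - x).
Proof. by rewrite -hnormN opprB. Qed.

Lemma hnorm0 : N 0 = 0.
Proof. by apply/eqP; rewrite hnorm_eq0. Qed.

Lemma dotC x y : dot x y = scalar_conj (dot y x).
Proof. by rewrite hermitian_subproof expr0 mul1r. Qed.

Lemma dotZr (c : K) x y : dot x (c *: y) = scalar_conj c * dot x y.
Proof. exact: linearr_subproof. Qed.

Definition rdot x y : R := scalar_re (dot x y).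

Lemma rdotC x y : rdot x y = rdot y x.
Proof. by rewrite /rdot dotC scalar_re_conj. Qed.

Lemma rdotDl x y z : rdot (x + y) z = rdot x z + rdot y z.
Proof. by rewrite /rdot linearDl scalar_reD. Qed.

Lemma rdotZl a x z : rdot (a%:K *: x) z = a * rdot x z.
Proof. by rewrite /rdot linearZl_LR /= scalar_reM. Qed.

Lemma rdotDr x y z : rdot z (x + y) = rdot z x + rdot z y.
Proof. by rewrite !(rdotC z) rdotDl. Qed.

Lemma rdotZr a x z : rdot z (a%:K *: x) = a * rdot z x.
Proof. by rewrite !(rdotC z) rdotZl. Qed.

Lemma rdotNl x z : rdot (- x) z = - rdot x z.
Proof. by rewrite -scaleN1r -of_real1 -of_realN rdotZl mulN1r. Qed.

Lemma rdotNr x z : rdot z (- x) = - rdot z x.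
Proof. by rewrite !(rdotC z) rdotNl. Qed.

Lemma rdot0l x : rdot 0 x = 0.
Proof. by rewrite -(scale0r 0) -of_real0 rdotZl mul0r. Qed.

Lemma rdotxx x : rdot x x = N x ^+ 2.
Proof. by rewrite /rdot dot_norm normr_hnorm -of_realX2 of_realK. Qed.

Lemma hnormDsq x y : N (x + y) ^+ 2 = N x ^+ 2 + 2 * rdot x y + N y ^+ 2.
Proof. by rewrite -!rdotxx !(rdotDl, rdotDr) (rdotC y x); ring. Qed.

Lemma parallelogram x y :
  N (x + y) ^+ 2 + N (x - y) ^+ 2 = 2 * N x ^+ 2 + 2 * N y ^+ 2.
Proof. by rewrite !hnormDsq rdotNr hnormN; ring. Qed.

(** The quadratic polynomial [t |-> |x - t y|^2] is nonnegative. *)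
Lemma ler_rdot x y : `|rdot x y| <= N x * N y.
Proof.
rewrite -ler_sqr ?nnegrE ?mulr_ge0 ?hnorm_ge0// real_normK ?num_real// exprMn.
apply: quadratic_discriminant; rewrite ?sqr_ge0// => t.
have := sqr_ge0 (N (x + (- t)%:K *: y)).
by rewrite hnormDsq rdotZr hnormZr exprMn real_normK ?num_real//; lra.
Qed.

(** Rotating [x] makes its inner product with [y] real; this transfers
    inequalities and orthogonality from [rdot] back to [dot]. *)
Lemma rdot_dot x y :
  rdot (scalar_conj (dot x y) *: x) y = scalar_re `|dot x y| ^+ 2.
Proof. by rewrite /rdot linearZl_LR /= scalar_re_conjM. Qed.

Lemma ler_dot x y : `|dot x y| <= `|x| * `|y|.
Proof.
rewrite !normr_hnorm -of_realM (ge0_of_real (normr_ge0 _)) ler_of_real.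
set d := scalar_re _.
have d0 : 0 <= d by rewrite -(ler_of_real s) of_real0 -ge0_of_real.
have := ler_norm (rdot (scalar_conj (dot x y) *: x) y).
move=> /le_trans /(_ (ler_rdot _ _)).
rewrite rdot_dot hnormZ norm_scalar_conj -/d expr2 -mulrA.
have [-> _|dn0] := eqVneq d 0; first by rewrite mulr_ge0 ?hnorm_ge0.
by rewrite ler_pM2l// lt_neqAle eq_sym dn0.
Qed.

Section Subspace.
Context (U : set H) (Ucl : closed_subspace U).

Lemma subspace0 : U 0.
Proof. by case: Ucl => _ [U0 _]; apply/set_mem. Qed.

Lemma subspaceP (c : K) x y : U x -> U y -> U (c *: x + y).
Proof. by case: Ucl => _ [_ UZ] Ux Uy; apply/set_mem/UZ; exact/mem_set. Qed.

Lemma subspaceZ (c : K) x : U x -> U (c *: x).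
Proof.
by move=> Ux; rewrite -[_ *: _]addr0; apply: subspaceP => //; exact: subspace0.
Qed.

Lemma subspaceD x y : U x -> U y -> U (x + y).
Proof. by move=> Ux Uy; rewrite -[x]scale1r; exact: subspaceP. Qed.

Lemma subspaceB x y : U x -> U y -> U (x - y).
Proof. by move=> Ux Uy; rewrite addrC -scaleN1r; exact: subspaceP. Qed.

End Subspace.

Lemma dot_eq0 (U : set H) y : closed_subspace U ->
  (forall x, U x -> rdot x y = 0) -> forall x, U x -> dot x y = 0.
Proof.
move=> Ucl xy x Ux; apply/eqP; rewrite -normr_eq0.
rewrite (ge0_of_real (normr_ge0 _)).
have := xy (scalar_conj (dot x y) *: x).
rewrite rdot_dot => /(_ _)/eqP; rewrite sqrf_eq0 => h.
rewrite (eqP (h _)) ?of_real0//.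
exact: subspaceZ.
Qed.

(** Positive scalars are real, so convergence may be tested with real radii. *)
Lemma hcvgP {T : Type} {F : set_system T} {FF : Filter F} (f : T -> H) (l : H) :
  f @ F --> l <-> forall e : R, 0 < e -> \forall t \near F, N (l - f t) < e.
Proof.
split=> [/cvgrPdist_lt h e e0|h].
  have /h : 0 < e%:K by rewrite -(of_real0 R s) ltr_of_real.
  by apply: filterS => t; rewrite normr_hnorm ltr_of_real.
apply/cvgrPdist_lt => e e0; have eE := ge0_of_real (ltW e0).
move: e0; rewrite eE -[0 < _]/((0 : K) < _) -(of_real0 R s) ltr_of_real => /h.
by apply: filterS => t; rewrite normr_hnorm ltr_of_real.
Qed.

Lemma hcauchy_cvg {F : set_system H} {FF : ProperFilter F} :
  (forall e : R, 0 < e -> exists x, F [set y | N (x - y) < e]) ->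
  exists l : H, F --> l.
Proof.
move=> h; exists (lim F); apply: cauchy_cvg; apply: cauchy_exP => e e0.
have eE := ge0_of_real (ltW e0).
move: e0; rewrite eE -[0 < _]/((0 : K) < _) -(of_real0 R s) ltr_of_real.
move=> /h[x hx]; exists x; apply: filterS hx => y /=.
by rewrite -ball_normE /= normr_hnorm ltr_of_real.
Qed.

(** Cantor's intersection principle, with a limit in the closures of the sets.
    It turns approximate solutions, unique up to a vanishing error, into an
    exact one: the sets generate a Cauchy filter. *)
Lemma nested_sets_limit (U : set H) (S : R -> set H) : closed U ->
  (forall d, 0 < d -> S d !=set0) ->
  (forall d, S d `<=` U) ->
  (forall d d', d <= d' -> S d `<=` S d') ->
  (forall e, 0 < e -> exists2 d, 0 < d &
     forall x y, S d x -> S d y -> N (x - y) < e) ->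
  exists2 l, U l &
    forall d e, 0 < d -> 0 < e -> exists2 x, S d x & N (l - x) < e.
Proof.
move=> Ucl S0 SU Smono Sdiam.
pose F := filter_from [set d : R | 0 < d] S.
have FF : ProperFilter F.
  apply: filter_from_proper => //; apply: filter_from_filter.
    by exists 1; rewrite /= ltr01.
  move=> d d' /= d0 d'0; exists (Num.min d d').
    by rewrite /= lt_min d0 d'0.
  by move=> x Sx; split; apply: Smono Sx; rewrite ge_min lexx ?orbT.
have [l Fl] : exists l : H, F --> l.
  apply: hcauchy_cvg => e /Sdiam[d d0 hd]; have [x Sx] := S0 _ d0.
  by exists x; exists d => // y Sy; exact: hd.
exists l => [|d e d0 e0].
  apply: (@closed_cvg _ _ F _ id U Ucl _ l Fl).
  by exists 1; [rewrite /= ltr01|exact: SU].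
have /hcvgP h : id @ F --> l by [].
have Sd : F (S d) by exists d.
by have [x [Sx ?]] := filter_ex (filterI Sd (h _ e0)); exists x.
Qed.


(** * Orthogonal projections *)

(** Two nearly closest points are close to each other: by the parallelogram
    law their distance is controlled by the excess of their distances to [x]
    over the infimum, since their midpoint is also in [U]. *)
Lemma closest_point (U : set H) x : closed_subspace U ->
  exists2 y, U y & forall z, U z -> N (x - y) <= N (x - z).
Proof.
move=> Ucl; pose D := [set N (x - y) | y in U]; pose d := inf D.
have D0 : D !=set0 by exists (N (x - 0)), 0 => //; exact: subspace0.
have Dlb : has_lbound D by exists 0 => _ [y _ <-]; exact: hnorm_ge0.
have dle y : U y -> d <= N (x - y) by move=> Uy; apply: ge_inf => //; exists y.
have d0 : 0 <= d by apply: lb_le_inf => // _ [y _ <-]; exact: hnorm_ge0.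
pose S t := [set y | U y /\ N (x - y) < d + t].
have [||||e e0|l Ul hl] := @nested_sets_limit U S.
- by case: Ucl.
- move=> t t0; have [_ [y Uy <-] yt] := inf_adherent t0 (conj D0 Dlb).
  by exists y.
- by move=> t y [].
- move=> t t' tt' y [Uy yt]; split => //.
  by apply: lt_le_trans yt _; rewrite lerD2l.
- (* the squared diameter is below 4 (d + t)^2 - 4 d^2 = 8 d t + 4 t^2, and
     this is at most (8 d + 5) t <= e^2 because t <= 1 *)
  pose t := Num.min 1 (e ^+ 2 / (8 * d + 5)).
  have d5 : 0 < 8 * d + 5 by lra.
  have t0 : 0 < t by rewrite lt_min ltr01 divr_gt0// exprn_gt0.
  have t1 : t <= 1 by rewrite ge_min lexx.
  have te : (8 * d + 5) * t <= e ^+ 2.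
    by rewrite -ler_pdivlMl// mulrC ge_min lexx orbT.
  exists t => // y z [Uy yt] [Uz zt].
  rewrite -ltr_sqr ?nnegrE ?hnorm_ge0 ?ltW//.
  have := parallelogram (x - y) (x - z).
  have -> : x - y - (x - z) = z - y by rewrite opprB addrC addrA subrK.
  have -> : x - y + (x - z) = 2%:K *: (x - 2^-1%:K *: (y + z)).
    rewrite scalerBr scalerA -of_realM mulfV// of_real1 scale1r.
    rewrite -[2]/(1 + 1) of_realD of_real1 scalerDl scale1r.
    by rewrite addrACA opprD.
  have := dle (2^-1%:K *: (y + z)) (subspaceZ Ucl _ (subspaceD Ucl Uy Uz)).
  rewrite hnormZr exprMn ger0_norm// (hnormB z).
  set u := N (x - _ *: _).
  set p := N (x - y) in yt *; set q := N (x - z) in zt *.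
  have p0 : 0 <= p by exact: hnorm_ge0.
  have q0 : 0 <= q by exact: hnorm_ge0.
  nra.
exists l => // z Uz; apply: le_trans (dle _ Uz).
apply/ler_addgt0Pr => e e0; have e2 : 0 < e / 2 by rewrite divr_gt0.
have [y [Uy yd] yl] := hl _ _ e2 e2.
have -> : x - l = (x - y) + (y - l) by rewrite addrA subrK.
apply: le_trans (ler_hnormD _ _) _; rewrite (hnormB y); lra.
Qed.

Lemma orthocomp_rdot (U : set H) x : closed_subspace U ->
  orthocomp dot U x <-> forall z, U z -> rdot x z = 0.
Proof.
move=> Ucl; split=> [h z /h|h z Uz].
  by rewrite /rdot => ->; rewrite -(of_real0 R s) of_realK.
rewrite dotC (dot_eq0 Ucl)//; last by move=> y /h; rewrite rdotC.
by rewrite -(of_real0 R s) conj_of_real.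
Qed.

(** First variation: moving from the closest point [y] to [y + t z] cannot
    decrease the distance, so the linear term in [t] vanishes. *)
Lemma closest_orthogonal (U : set H) x y : closed_subspace U -> U y ->
  (forall z, U z -> N (x - y) <= N (x - z)) -> orthocomp dot U (x - y).
Proof.
move=> Ucl Uy hy; apply/orthocomp_rdot => // z Uz; apply/eqP.
rewrite -sqrf_eq0 eq_le sqr_ge0 andbT -[leRHS](mul0r (N z ^+ 2)).
apply: quadratic_discriminant; rewrite ?sqr_ge0// => t.
have := hy _ (subspaceD Ucl Uy (subspaceZ Ucl t%:K Uz)).
rewrite -ler_sqr ?nnegrE ?hnorm_ge0// opprD addrA.
rewrite [leRHS]hnormDsq rdotNr rdotZr hnormN hnormZr exprMn.
rewrite real_normK ?num_real//; lra.
Qed.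

Lemma orthocomp_linear (U : set H) (c : K) x y :
  orthocomp dot U x -> orthocomp dot U y -> orthocomp dot U (c *: x + y).
Proof.
by move=> hx hy z Uz; rewrite linearDl linearZl_LR /= hx// hy// mulr0 addr0.
Qed.

Section Orthoproj.
Context (U : set H) (Ucl : closed_subspace U).
Local Notation P := (orthoproj dot U).

Lemma orthoprojP x : U (P x) /\ orthocomp dot U (x - P x).
Proof.
apply: (@xgetPex _ 0 [set y | U y /\ orthocomp dot U (x - y)]).
have [y Uy yle] := closest_point x Ucl.
by exists y; split => //; exact: closest_orthogonal.
Qed.

Lemma orthoproj_mem x : U (P x). Proof. by have [] := orthoprojP x. Qed.

Lemma orthoproj_unique x y : U y -> orthocomp dot U (x - y) -> P x = y.
Proof.
move=> Uy Uxy; have [UP UxP] := orthoprojP x.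
have UPy := subspaceB Ucl UP Uy.
apply/eqP; rewrite -subr_eq0 -hnorm_eq0 -sqrf_eq0 -rdotxx.
have := orthocomp_linear (-1) UxP Uxy; rewrite scaleN1r opprB subrKA.
by rewrite orthocomp_rdot// => ->.
Qed.

Lemma orthoproj_linear (c : K) x y : P (c *: x + y) = c *: P x + P y.
Proof.
have [Ux xU] := orthoprojP x; have [Uy yU] := orthoprojP y.
apply: orthoproj_unique; first exact: subspaceP.
rewrite opprD addrACA -scalerBr; exact: orthocomp_linear.
Qed.

Lemma orthoprojZ (c : K) x : P (c *: x) = c *: P x.
Proof.
have [Ux xU] := orthoprojP x.
apply: orthoproj_unique; first exact: subspaceZ.
by move=> z Uz; rewrite -scalerBr linearZl_LR /= xU// mulr0.
Qed.

Lemma dot_orthoproj z x : U z -> dot z (P x) = dot z x.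
Proof.
move=> Uz; have [_ h] := orthoprojP x.
rewrite -[in RHS](subrK (P x) x) linearDr /= [dot z (x - _)]dotC h//.
by rewrite -(of_real0 R s) conj_of_real of_real0 add0r.
Qed.

Lemma rdot_orthoproj z x : U z -> rdot z (P x) = rdot z x.
Proof. by move=> Uz; rewrite /rdot dot_orthoproj. Qed.

Lemma hnorm_orthoproj x : N (P x) <= N x.
Proof.
have := ler_rdot (P x) x; rewrite -(rdot_orthoproj _ (orthoproj_mem x)) rdotxx.
rewrite ger0_norm ?sqr_ge0// expr2.
have [->|n0] := eqVneq (N (P x)) 0; first by rewrite hnorm_ge0.
by rewrite ler_pM2l// lt_neqAle eq_sym n0 hnorm_ge0.
Qed.

End Orthoproj.

Lemma orthoproj_comp (U V : set H) x : closed_subspace U -> closed_subspace V ->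
  U `<=` V -> orthoproj dot U (orthoproj dot V x) = orthoproj dot U x.
Proof.
move=> Ucl Vcl UV; have [Vx xV] := orthoprojP Vcl x.
have [Ux xU] := orthoprojP Ucl (orthoproj dot V x).
apply/esym/orthoproj_unique => // z Uz.
rewrite -(subrKA (orthoproj dot V x)) linearDl /= xU// xV ?addr0//.
exact: UV.
Qed.

End Inner.

(** * Sums over finite subsets of the index set *)

#[local] Existing Instance summability.totally_filter.

Section FiniteSums.
Context (R : realType) (I : choiceType).
Implicit Types (A B : {fset I}) (a b : I -> R).

Lemma sum_fsetD (V : zmodType) (F : I -> V) A B : (A `<=` B)%fset ->
  \sum_(i <- B) F i = \sum_(i <- A) F i + \sum_(i <- (B `\` A)%fset) F i.
Proof.
move=> AB; rewrite (big_fsetID _ (mem A)) /=.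
have -> : [fset x in B | x \in A]%fset = A.
  apply/fsetP => i; rewrite !inE/=.
  by case: (boolP (i \in A)) => [/(fsubsetP AB)->|_]; rewrite ?andbF.
suff -> : [fset x in B | x \notin A]%fset = (B `\` A)%fset by [].
by apply/fsetP => i; rewrite !inE/= andbC.
Qed.

Lemma sum_CauchySchwarz (r : seq I) a b :
  (\sum_(i <- r) a i * b i) ^+ 2 <=
  (\sum_(i <- r) a i ^+ 2) * (\sum_(i <- r) b i ^+ 2).
Proof.
apply: quadratic_discriminant; try by apply: sumr_ge0 => i _; exact: sqr_ge0.
move=> t; rewrite !mulr_sumr -sumrN -!big_split /=.
apply: sumr_ge0 => i _; have := sqr_ge0 (a i - t * b i); nra.
Qed.

Lemma fsum_fset a A :
  (\sum_(i \in [set` A]) (a i)%:E)%E = (\sum_(i <- A) a i)%:E.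
Proof. by rewrite fsbig_finite//= set_fsetK sumEFin. Qed.

Lemma esum_le_fset a (c : R) : (forall A, \sum_(i <- A) a i <= c) ->
  (\esum_(i in [set: I]) (a i)%:E <= c%:E)%E.
Proof.
move=> h; apply: ge_ereal_sup => _ [D [Dfin _] <-].
by rewrite fsbig_finite//= sumEFin lee_fin.
Qed.

Lemma fset_le_esum a A :
  ((\sum_(i <- A) a i)%:E <= \esum_(i in [set: I]) (a i)%:E)%E.
Proof. by apply: ereal_sup_ubound; exists [set` A] => //; exact: fsum_fset. Qed.

Lemma esum_approx a (e : R) : 0 < e ->
  (forall i, 0 <= a i) -> (\esum_(i in [set: I]) (a i)%:E < +oo)%E ->
  exists A, fine (\esum_(i in [set: I]) (a i)%:E) - e < \sum_(i <- A) a i.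
Proof.
move=> e0 a0 afin; have Sfin : \esum_(i in [set: I]) (a i)%:E \is a fin_num.
  by rewrite ge0_fin_numE// esum_ge0// => i _; rewrite lee_fin.
have [_ [D [Dfin _] <-]] := ub_ereal_sup_adherent e0 Sfin.
rewrite -/(esum _ _) fsbig_finite//= sumEFin -{1}(fineK Sfin) lte_fin => h.
by exists (fset_set D).
Qed.

Lemma fset_le_fine_esum a A :
  (forall i, 0 <= a i) -> (\esum_(i in [set: I]) (a i)%:E < +oo)%E ->
  \sum_(i <- A) a i <= fine (\esum_(i in [set: I]) (a i)%:E).
Proof.
move=> a0 afin; rewrite -lee_fin fineK ?fset_le_esum//.
by rewrite ge0_fin_numE// esum_ge0// => i _; rewrite lee_fin.
Qed.

Lemma partial_sumE (V : zmodType) (x : I -> V) A :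
  summability.partial_sum x A = \sum_(i <- A) x i.
Proof. by rewrite /summability.partial_sum big_seq_fsetE. Qed.

Lemma sum_cvgE (K : numFieldType) (V : normedModType K) (x : I -> V) (l : V) :
  summability.partial_sum x @ summability.totally --> l ->
  summability.sum x = l.
Proof. by rewrite /summability.sum => /cvg_lim ->//; exact: norm_hausdorff. Qed.

Lemma partial_sum_single (V : zmodType) (x : I -> V) j A : j \in A ->
  (forall i, i != j -> x i = 0) -> summability.partial_sum x A = x j.
Proof.
move=> jA x0; rewrite partial_sumE (big_fsetD1 j)//= big_seq big1 ?addr0//.
by move=> i; rewrite !inE => /andP[/x0].
Qed.

Lemma near_totally_mem j : \forall A \near @summability.totally I, j \in A.
Proof. by exists [fset j]%fset => // A /=; rewrite fsub1set. Qed.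

(** A family supported at [j] has all its partial sums over sets containing
    [j] equal to its value there, so the net of partial sums is eventually
    constant. *)
Lemma sum_single (K : numFieldType) (V : normedModType K) (x : I -> V) j :
  (forall i, i != j -> x i = 0) -> summability.sum x = x j.
Proof.
move=> x0; apply: sum_cvgE.
apply: cvg_near_cst; apply: filterS (near_totally_mem j) => A jA.
exact: partial_sum_single.
Qed.

End FiniteSums.

(** * Synthesis and analysis for fusion Bessel sequences *)

Section Fusion.
Context (R : realType) (s : scalar_kind).
Local Notation K := (scalars R s).
Context (H : completeNormedModType K) (dot : {dot H for @scalar_conj R s}).
Hypothesis dot_norm : forall x : H, dot x x = `|x| ^+ 2.
Context (I : countType).
Implicit Types (x y z : H) (f g : I -> H) (A B : {fset I}).

Local Notation N := (@hnorm R s H).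
Local Notation "a %:K" := (of_real s a) (at level 2, format "a %:K").
Local Notation rdot := (@rdot R s H dot).
Local Notation oproj U := (orthoproj dot U).
Local Notation totally := (@summability.totally I).

Lemma dot_suml (r : seq I) f x :
  dot (\sum_(i <- r) f i) x = \sum_(i <- r) dot (f i) x.
Proof.
by elim/big_rec2: _ => [|i y1 y2 _ <-]; rewrite ?linearDl ?linear0l.
Qed.

Lemma rdot_suml (r : seq I) f x :
  rdot (\sum_(i <- r) f i) x = \sum_(i <- r) rdot (f i) x.
Proof.
by elim/big_rec2: _ => [|i y1 y2 _ <-]; rewrite ?rdotDl ?rdot0l.
Qed.

Lemma sqsum_ge0 f : (0 <= sqsum f)%E.
Proof. by apply: esum_ge0 => i _; rewrite lee_fin sqr_ge0. Qed.

Lemma frame_sum_ge0 (Ui : I -> set H) (u : I -> R) x :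
  (0 <= frame_sum dot Ui u x)%E.
Proof. by apply: esum_ge0 => i _; rewrite lee_fin mulr_ge0 ?sqr_ge0. Qed.

Lemma hsum_norm_sqr f : hsum_norm f ^+ 2 = fine (sqsum f).
Proof. by rewrite /hsum_norm sqr_sqrtr// fine_ge0// sqsum_ge0. Qed.

Lemma partial_le_hsum_norm (Ui : I -> set H) f A : hsum Ui f ->
  \sum_(i <- A) N (f i) ^+ 2 <= hsum_norm f ^+ 2.
Proof.
move=> [_ ffin]; rewrite hsum_norm_sqr fset_le_fine_esum// => i.
exact: sqr_ge0.
Qed.

Lemma single_hsum (Ui : I -> set H) j z :
  (forall i, closed_subspace (Ui i)) -> Ui j z ->
  hsum Ui (component j (fun=> z)).
Proof.
move=> Ucl Uz; split => [i|].
  by rewrite /component; case: eqP => [->//|_]; exact: subspace0.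
apply: le_lt_trans (esum_le_fset (c := N z ^+ 2) _) (ltry _) => A.
have [jA|jA] := boolP (j \in A).
  rewrite (big_fsetD1 j)//= big_seq big1 ?addr0.
    by rewrite /component eqxx.
  move=> i; rewrite !inE /component => /andP[/negPf -> _].
  by rewrite hnorm0 expr0n.
rewrite big_seq big1 ?sqr_ge0// => i iA; rewrite /component.
by case: eqP iA jA => [->->//|_ _ _]; rewrite hnorm0 expr0n.
Qed.

Lemma synthesis_component (u : I -> R) j f :
  synthesis u (component j f) = (u j)%:K *: f j.
Proof.
rewrite /synthesis (sum_single (j := j)) /component ?eqxx//.
by move=> i /negPf ->; rewrite scaler0.
Qed.

Lemma fusion_frame_bessel (V : set H) (Ui : I -> set H) (u : I -> R) :
  fusion_frame dot V Ui u -> fusion_bessel dot V Ui u.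
Proof.
move=> [UV uw [a [b [a0 ab h]]]]; split => //; exists b.
  exact: lt_le_trans ab.
by move=> x /h[].
Qed.

Section Bessel.
Context (V : set H) (Ui : I -> set H) (u : I -> R).
Hypothesis V_closed : closed_subspace V.
Hypothesis U_bessel : fusion_bessel dot V Ui u.

Local Notation psum f := (summability.partial_sum (fun i => (u i)%:K *: f i)).

Let Ucl i : closed_subspace (Ui i).
Proof. by case: U_bessel => /(_ i)[]. Qed.

Let UV i : Ui i `<=` V.
Proof. by case: U_bessel => /(_ i)[]. Qed.

(** The partial sums pair with [x] as [f] pairs with the analysis of [x];
    this inequality gives both the convergence of the synthesis series and
    the lower frame bound. *)
Lemma rdot_partial_synthesis f x A : (forall i, Ui i (f i)) ->
  rdot (psum f A) x ^+ 2 <=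
  (\sum_(i <- A) N (f i) ^+ 2) *
  (\sum_(i <- A) u i ^+ 2 * N (oproj (Ui i) x) ^+ 2).
Proof.
move=> Uf; rewrite partial_sumE rdot_suml.
have -> : \sum_(i <- A) u i ^+ 2 * N (oproj (Ui i) x) ^+ 2 =
    \sum_(i <- A) (`|u i| * N (oproj (Ui i) x)) ^+ 2.
  by apply: eq_bigr => i _; rewrite exprMn real_normK ?num_real.
apply: le_trans (sum_CauchySchwarz _ _ _).
rewrite -[leLHS]real_normK ?num_real// ler_sqr ?nnegrE ?normr_ge0//; last first.
  by apply: sumr_ge0 => i _; rewrite !mulr_ge0 ?hnorm_ge0.
apply: le_trans (ler_norm_sum _ _ _) _; apply: ler_sum => i _.
rewrite rdotZl -(rdot_orthoproj dot_norm (Ucl i) _ (Uf i)) normrM mulrCA.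
by rewrite ler_wpM2l// ler_rdot.
Qed.

Lemma partial_synthesis_mem f A : (forall i, Ui i (f i)) -> V (psum f A).
Proof.
move=> Uf; rewrite partial_sumE; elim/big_ind: _ => [|x y|i _].
- exact: subspace0.
- exact: subspaceD.
- by apply: subspaceZ => //; exact: UV.
Qed.

(** Pair the partial sum [y] with itself and cancel one factor [|y|^2]. *)
Lemma hnorm_partial_synthesis (b : R) f A : 0 <= b ->
  (forall x, V x -> (frame_sum dot Ui u x <= (b * N x ^+ 2)%:E)%E) ->
  (forall i, Ui i (f i)) ->
  N (psum f A) ^+ 2 <= b * \sum_(i <- A) N (f i) ^+ 2.
Proof.
move=> b0 Ub Uf; set y := psum f A.
have Vy : V y by exact: partial_synthesis_mem.
have := rdot_partial_synthesis y A Uf; rewrite -/y rdotxx//.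
have : \sum_(i <- A) u i ^+ 2 * N (oproj (Ui i) y) ^+ 2 <= b * N y ^+ 2.
  rewrite -lee_fin; apply: le_trans (Ub _ Vy).
  exact: (fset_le_esum (fun i => u i ^+ 2 * N (oproj (Ui i) y) ^+ 2)).
set c := \sum_(i <- A) N (f i) ^+ 2; set d := \sum_(i <- A) _ => dle cd.
have c0 : 0 <= c by apply: sumr_ge0 => i _; exact: sqr_ge0.
have := le_trans cd (ler_wpM2l c0 dle); rewrite mulrA [_ ^+ 2 ^+ 2]expr2.
have [->|n0] := eqVneq (N y ^+ 2) 0; first by rewrite mulr_ge0.
by rewrite ler_pM2r 1?mulrC// lt_neqAle eq_sym n0 sqr_ge0.
Qed.

(** The net of partial sums is Cauchy: two of them differ by a sum over
    indices outside of a large finite set, where [f] has little mass. *)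
Lemma synthesis_cvg f : hsum Ui f -> psum f @ totally --> synthesis u f.
Proof.
move=> [Uf ffin]; have [_ _ [b b0 Ub]] := U_bessel.
suff [l hl] : exists l : H, psum f @ totally --> l.
  by rewrite /synthesis (sum_cvgE hl).
apply: hcauchy_cvg => e e0; pose d := e ^+ 2 / b.
have d0 : 0 < d by rewrite divr_gt0// exprn_gt0.
have [A hA] := esum_approx d0 (fun i => sqr_ge0 (N (f i))) ffin.
exists (psum f A); exists A => // B /= AB.
have -> : psum f A - psum f B = - psum f (B `\` A)%fset.
  by rewrite !partial_sumE (sum_fsetD _ AB) opprD addrA subrr add0r.
rewrite hnormN -ltr_sqr ?nnegrE ?hnorm_ge0 ?ltW//.
apply: le_lt_trans (hnorm_partial_synthesis _ (ltW b0) Ub Uf) _.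
rewrite mulrC -ltr_pdivlMr// -/d.
have := fset_le_fine_esum B (fun i => sqr_ge0 (N (f i))) ffin.
by rewrite (sum_fsetD _ AB); lra.
Qed.

Lemma synthesis_mem f : hsum Ui f -> V (synthesis u f).
Proof.
move=> Uf; case: (V_closed) => Vc _.
apply: (@closed_cvg _ _ totally _ (psum f) V Vc _ _ (synthesis_cvg Uf)).
by apply: nearW => A; apply: partial_synthesis_mem; case: Uf.
Qed.

Lemma synthesis_linear (c : K) f g h : hsum Ui f -> hsum Ui g -> hsum Ui h ->
  h =1 (fun i => c *: f i + g i) ->
  synthesis u h = c *: synthesis u f + synthesis u g.
Proof.
move=> Uf Ug Uh hE; apply: sum_cvgE.
have -> : psum h = fun A => c *: psum f A + psum g A.
  apply/funext => A; rewrite !partial_sumE scaler_sumr -big_split /=.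
  by apply: eq_bigr => i _; rewrite hE scalerDr !scalerA mulrC.
by apply: cvgD; [apply: cvgZl_tmp|]; exact: synthesis_cvg.
Qed.

Lemma frame_sum_lty x : V x -> (frame_sum dot Ui u x < +oo)%E.
Proof.
by case: U_bessel => _ _ [b _ Ub] /Ub/le_lt_trans; apply; exact: ltry.
Qed.

(** The Cauchy-Schwarz inequality for [f] and the analysis of [x], obtained by
    passing to the limit in [rdot_partial_synthesis]. *)
Lemma rdot_synthesis f x : hsum Ui f -> V x ->
  rdot (synthesis u f) x ^+ 2 <=
  hsum_norm f ^+ 2 * fine (frame_sum dot Ui u x).
Proof.
move=> Uf Vx; set c := _ * _.
have c0 : 0 <= c by rewrite mulr_ge0 ?sqr_ge0 ?fine_ge0 ?frame_sum_ge0.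
rewrite -(sqr_sqrtr c0) -[leLHS]real_normK ?num_real//.
rewrite ler_sqr ?nnegrE ?normr_ge0 ?sqrtr_ge0//.
apply/ler_addgt0Pr => e e0.
have /hcvgP h := synthesis_cvg Uf.
have e1 : 0 < e / (N x + 1) by rewrite divr_gt0// ltr_wpDl ?hnorm_ge0.
have [A hA] := filter_ex (h _ e1).
have -> : synthesis u f = psum f A + (synthesis u f - psum f A).
  by rewrite addrC subrK.
rewrite rdotDl; apply: le_trans (ler_normD _ _) _; apply: lerD.
  rewrite -ler_sqr ?nnegrE ?normr_ge0 ?sqrtr_ge0// sqr_sqrtr//.
  rewrite real_normK ?num_real//.
  apply: le_trans (rdot_partial_synthesis _ _ _) _; first by case: Uf.
  apply: ler_pM.
  - by apply: sumr_ge0 => i _; exact: sqr_ge0.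
  - by apply: sumr_ge0 => i _; rewrite mulr_ge0 ?sqr_ge0.
  - exact: partial_le_hsum_norm Uf.
  - apply: fset_le_fine_esum => [i|]; first by rewrite mulr_ge0 ?sqr_ge0.
    exact: frame_sum_lty.
apply: le_trans (ler_rdot dot_norm _ _) _.
have xn : 0 <= N x by exact: hnorm_ge0.
move: hA; rewrite ltr_pdivlMr; last by lra.
set p := N _ => pe; have p0 : 0 <= p by exact: hnorm_ge0.
nra.
Qed.

(** The frame sum is only controlled on [V], but projecting [x] onto [V] first
    does not change its projections onto the subspaces of [V]. *)
Lemma sqsum_weighted_proj x :
  sqsum (fun i => (u i)%:K *: oproj (Ui i) x) =
  frame_sum dot Ui u (oproj V x).
Proof.
apply: eq_esum => i _; rewrite hnormZr exprMn real_normK ?num_real//.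
by rewrite orthoproj_comp.
Qed.

Lemma weighted_proj_hsum x : hsum Ui (fun i => (u i)%:K *: oproj (Ui i) x).
Proof.
split=> [i|]; first by apply: subspaceZ => //; exact: orthoproj_mem.
by rewrite sqsum_weighted_proj; apply: frame_sum_lty; exact: orthoproj_mem.
Qed.

(** Existence: pairing the weighted projections with [f] gives the limit of the
    pairings of the partial sums with [x].  Uniqueness: testing the adjoint
    relation on families supported at one index [j] determines the component
    at [j], as an orthogonal projection onto [Ui j]. *)
Lemma analysisE x :
  analysis dot Ui u x = fun i => (u i)%:K *: oproj (Ui i) x.
Proof.
pose g0 i := (u i)%:K *: oproj (Ui i) x.
pose S := [set g | hsum Ui g /\
  forall f, hsum Ui f -> dot (synthesis u f) x = hsum_dot dot f g].
have Sg0 : S g0.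
  split; first exact: weighted_proj_hsum.
  move=> f Uf; apply/esym/sum_cvgE.
  have -> : summability.partial_sum (fun i => dot (f i) (g0 i) : K^o) =
      fun A => dot (psum f A) x.
    apply/funext => A; rewrite !partial_sumE dot_suml.
    apply: eq_bigr => i _; rewrite dotZr conj_of_real dot_orthoproj//.
      by rewrite linearZl_LR.
    by case: Uf.
  apply/cvgrPdist_lt => e e0.
  have d0 : 0 < e / (`|x| + 1) by rewrite divr_gt0// ltr_wpDl.
  have /cvgrPdist_lt /(_ _ d0) := synthesis_cvg Uf.
  apply: filterS => A; rewrite ltr_pdivlMr ?ltr_wpDl// => hA.
  rewrite -linearBl /=; apply: le_lt_trans (ler_dot dot_norm _ _) _.
  by apply: le_lt_trans hA; rewrite ler_wpM2l// lerDl.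
have [Ug hg] : S (analysis dot Ui u x).
  by apply: (@xgetPex _ 0 S); exists g0.
apply/funext => j; apply/esym.
rewrite -orthoprojZ//; apply: orthoproj_unique => //; first by case: Ug.
move=> z Uz; rewrite dotC linearBr /=.
suff -> : dot z (analysis dot Ui u x j) = dot z ((u j)%:K *: x).
  by rewrite subrr -(of_real0 R s) conj_of_real.
have := hg _ (single_hsum Ucl Uz).
rewrite synthesis_component /hsum_dot (sum_single (j := j)).
  by rewrite /component eqxx => <-; rewrite dotZr conj_of_real linearZl_LR.
by move=> i /negPf ij; rewrite /component ij linear0l.
Qed.

Lemma analysis_hsum x : hsum Ui (analysis dot Ui u x).
Proof. by rewrite analysisE; exact: weighted_proj_hsum. Qed.

Lemma analysis_bounded : exists2 b, 0 < b &
  forall x, hsum_norm (analysis dot Ui u x) ^+ 2 <= b * N x ^+ 2.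
Proof.
have [_ _ [b b0 Ub]] := U_bessel; exists b => // x.
rewrite hsum_norm_sqr analysisE sqsum_weighted_proj.
have VP := orthoproj_mem dot_norm V_closed x.
rewrite -lee_fin fineK ?ge0_fin_numE ?frame_sum_ge0 ?frame_sum_lty//.
apply: le_trans (Ub _ VP) _.
by rewrite lee_fin ler_pM2l// ler_sqr ?nnegrE ?hnorm_ge0// hnorm_orthoproj.
Qed.

Lemma analysis_linear (c : K) x y :
  analysis dot Ui u (c *: x + y) =
  c *: analysis dot Ui u x + analysis dot Ui u y.
Proof.
rewrite !analysisE; apply/funext => i.
by rewrite orthoproj_linear// scalerDr !scalerA mulrC -scalerA.
Qed.

(** A bounded linear map passes through the synthesis series.  The weights [vt]
    cancel, which is why they may be chosen independently of [u]. *)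
Lemma synthesis_image (vt : I -> R) (T : H -> H) f :
  bounded_op N N V V T -> (forall i, vt i != 0) -> hsum Ui f ->
  synthesis vt (component_op (T \o @synthesis R s H I u) vt f) =
  T (synthesis u f).
Proof.
move=> [TV Tlin [C TC]] vt0 Uf.
have V0 := subspace0 V_closed.
have T0 : T 0 = 0.
  have := Tlin (-1) 0 0 V0 V0.
  by rewrite scaler0 addr0 scaleN1r addNr.
have Vf i : V ((u i)%:K *: f i).
  by apply: subspaceZ => //; apply: UV; case: Uf.
set QT := component_op _ vt f.
have QTE i : (vt i)%:K *: QT i = T ((u i)%:K *: f i).
  rewrite /QT /component_op /= synthesis_component scalerA -of_realV.
  by rewrite -of_realM mulfV// of_real1 scale1r.
apply: sum_cvgE.
have -> : summability.partial_sum (fun i => (vt i)%:K *: QT i) = T \o psum f.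
  apply/funext => B; rewrite /= !partial_sumE.
  suff [-> //] : \sum_(i <- B) (vt i)%:K *: QT i =
      T (\sum_(i <- B) (u i)%:K *: f i) /\ V (\sum_(i <- B) (u i)%:K *: f i).
  elim/big_rec2: _ => [|i x y _ [-> Vx]]; first by rewrite T0.
  split; last exact: subspaceD.
  by rewrite QTE -[(u i)%:K *: f i in RHS]scale1r Tlin// scale1r.
apply/hcvgP => e e0.
have C0 : 0 < `|C| + 1 by rewrite ltr_wpDl.
have d0 : 0 < e / (`|C| + 1) by rewrite divr_gt0.
have /hcvgP/(_ _ d0) := synthesis_cvg Uf.
apply: filterS => B; rewrite ltr_pdivlMr// => hB /=.
have Vs := synthesis_mem Uf.
have Vp : V (psum f B) by apply: partial_synthesis_mem; case: Uf.
have -> : T (synthesis u f) - T (psum f B) = T (synthesis u f - psum f B).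
  by rewrite addrC -scaleN1r -Tlin// scaleN1r addrC.
apply: le_lt_trans (TC _ (subspaceB V_closed Vs Vp)) _.
apply: le_lt_trans hB; rewrite mulrC ler_wpM2l ?hnorm_ge0//.
by apply: le_trans (ler_norm _) _; rewrite lerDl.
Qed.

End Bessel.
End Fusion.

(** * Perturbations of the identity *)

Section NearIdentity.
Context (R : realType) (s : scalar_kind).
Context (H : completeNormedModType (scalars R s)).
Local Notation N := (@hnorm R s H).
Context (V : set H) (L : H -> H) (eps : R).
Hypothesis V_closed : closed_subspace V.
Hypothesis L_mem : forall x, V x -> V (L x).
Hypothesis L_linear : forall (c : scalars R s) x y, V x -> V y ->
  L (c *: x + y) = c *: L x + L y.
Hypothesis L_id : forall x, V x -> N (L x - x) <= eps * N x.
Hypothesis eps_ge0 : 0 <= eps.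
Hypothesis eps_lt1 : eps < 1.

Let L_sub x y : V x -> V y -> L (x - y) = L x - L y.
Proof. by move=> Vx Vy; rewrite addrC -scaleN1r L_linear// scaleN1r addrC. Qed.

Lemma near_identity_lower x : V x -> (1 - eps) * N x <= N (L x).
Proof.
move=> Vx; have := L_id Vx; have := ler_hnormD (x - L x) (L x).
by rewrite subrK hnormB; lra.
Qed.

Lemma near_identity_upper x : V x -> N (L x) <= (1 + eps) * N x.
Proof.
move=> Vx; have := L_id Vx; have := ler_hnormD (L x - x) x.
by rewrite subrK; lra.
Qed.

(** Adding the residual [y - L x] to [x] multiplies the norm of the residual by
    at most [eps]; so the infimum [r] of these norms satisfies [r <= eps r]
    and is zero. *)
Lemma near_identity_approx_solution y d : V y -> 0 < d ->
  exists2 x, V x & N (y - L x) < d.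
Proof.
move=> Vy d0; pose D := [set N (y - L x) | x in V]; pose r := inf D.
have D0 : D !=set0 by exists (N (y - L 0)), 0 => //; exact: subspace0.
have Dlb : has_lbound D by exists 0 => _ [x _ <-]; exact: hnorm_ge0.
have rle x : V x -> r <= N (y - L x).
  by move=> Vx; apply: ge_inf => //; exists x.
have r0 : 0 <= r by apply: lb_le_inf => // _ [x _ <-]; exact: hnorm_ge0.
suff rd : 0 < d - r.
  have [_ [x Vx <-] xd] := inf_adherent rd (conj D0 Dlb).
  by exists x => //; rewrite -/r in xd; lra.
rewrite subr_gt0 ltNge; apply/negP => dr.
(* the slack (1 - eps) r suffices: eps (r + (1 - eps) r) < r *)
have r1 : 0 < (1 - eps) * r.
  by rewrite mulr_gt0 ?subr_gt0//; exact: lt_le_trans dr.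
have [_ [x Vx <-]] := inf_adherent r1 (conj D0 Dlb).
rewrite -/r => xr.
have Vz : V (y - L x) by apply: subspaceB => //; exact: L_mem.
have := rle _ (subspaceD V_closed Vz Vx).
have -> : y - L ((y - L x) + x) = - (L (y - L x) - (y - L x)).
  rewrite -{1}[y - L x]scale1r L_linear// scale1r.
  by rewrite opprB opprD addrA addrAC.
rewrite hnormN => /le_trans /(_ (L_id Vz)).
have := ler_wpM2l eps_ge0 (ltW xr).
have : 0 < (1 - eps) * ((1 - eps) * r) by rewrite mulr_gt0 ?subr_gt0.
set n := N (y - L x); lra.
Qed.

(** By the lower bound, approximate solutions are close to each other, so they
    converge to a solution. *)
Lemma near_identity_surjective y : V y -> exists2 x, V x & L x = y.
Proof.
move=> Vy; pose S d := [set x | V x /\ N (y - L x) < d].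
have [||||e e0|l Vl hl] := @nested_sets_limit R s H V S.
- by case: V_closed.
- move=> d d0; have [x Vx xd] := near_identity_approx_solution Vy d0.
  by exists x.
- by move=> d x [].
- by move=> d d' dd' x [Vx xd]; split => //; exact: lt_le_trans xd dd'.
- have e1 : 0 < (1 - eps) * e / 2 by rewrite divr_gt0// mulr_gt0 ?subr_gt0//.
  exists ((1 - eps) * e / 2) => // x z [Vx xd] [Vz zd].
  have := near_identity_lower (subspaceB V_closed Vx Vz); rewrite L_sub//.
  have := ler_hnormD (L x - y) (y - L z); rewrite subrKA (hnormB _ y) => h1 h2.
  have : (1 - eps) * N (x - z) < (1 - eps) * e by lra.
  by rewrite ltr_pM2l ?subr_gt0//.
exists l => //; apply/eqP; rewrite eq_sym -subr_eq0 -hnorm_eq0.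
rewrite eq_le hnorm_ge0 andbT.
apply/ler_addgt0Pr => e e0; rewrite add0r.
have e4 : 0 < e / 4 by rewrite divr_gt0.
have [x [Vx xd] xl] := hl _ _ e4 e4.
have := near_identity_upper (subspaceB V_closed Vx Vl); rewrite L_sub//.
have := ler_hnormD (y - L x) (L x - L l); rewrite subrKA (hnormB x).
have := ler_piMl (hnorm_ge0 (l - x)) (ltW eps_lt1).
set p := N (l - x) in xl *; set q := N (L x - _).
set t := N (y - L x) in xd *.
lra.
Qed.

Lemma near_identity_inverse_bounded A : inverse_on V L A ->
  bounded_op N N V V A.
Proof.
move=> [_ AV AL LA]; split => //.
  move=> c x y Vx Vy; rewrite -{1}(LA _ Vx) -{1}(LA _ Vy).
  have [VAx VAy] := (AV _ Vx, AV _ Vy).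
  by rewrite -L_linear ?AL//; exact: subspaceP.
exists (1 - eps)^-1 => x Vx; rewrite ler_pdivlMl ?subr_gt0//.
by have := near_identity_lower (AV _ Vx); rewrite LA.
Qed.

Lemma near_identity_inverse :
  exists A, bounded_op N N V V A /\ inverse_on V L A.
Proof.
pose A y := xget 0 [set x | V x /\ L x = y].
have AP y : V y -> V (A y) /\ L (A y) = y.
  move=> Vy; apply: (@xgetPex _ 0 [set x | V x /\ L x = y]).
  by have [x] := near_identity_surjective Vy; exists x.
have AI : inverse_on V L A.
  split => // [x /AP[]//|x Vx|x /AP[]//].
  have [VA LA] := AP _ (L_mem Vx).
  have := near_identity_lower (subspaceB V_closed VA Vx).
  rewrite L_sub// LA subrr hnorm0 pmulr_rle0 ?subr_gt0//.
  move=> h; apply/eqP; rewrite -subr_eq0 -hnorm_eq0 eq_le h.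
  exact: hnorm_ge0.
by exists A; split => //; exact: near_identity_inverse_bounded.
Qed.

End NearIdentity.

(** * Oblique duality *)

Section Duality.
Context (R : realType) (s : scalar_kind).
Local Notation K := (scalars R s).
Context (H : completeNormedModType K) (dot : {dot H for @scalar_conj R s}).
Hypothesis dot_norm : forall x : H, dot x x = `|x| ^+ 2.
Context (V W : set H).
Hypothesis V_closed : closed_subspace V.
Hypothesis W_closed : closed_subspace W.
Implicit Types (x y z : H).

Local Notation N := (@hnorm R s H).

Section ObliqueProjection.
Hypothesis VW_sum : direct_sum V (orthocomp dot W).
Local Notation P := (Defs.proj V (orthocomp dot W)).

Lemma projP x : V (P x) /\ orthocomp dot W (x - P x).
Proof.
apply: (@xgetPex _ 0 [set y | V y /\ orthocomp dot W (x - y)]).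
have [_ /(_ x)[y [z [Vy Wz ->]]]] := VW_sum.
by exists y; split => //; rewrite addrC addKr.
Qed.

Lemma proj_id x : V x -> P x = x.
Proof.
move=> Vx; have [VP WP] := projP x; have [VW0 _] := VW_sum.
have : (V `&` orthocomp dot W) (x - P x) by split => //; exact: subspaceB.
by rewrite VW0 /= => /eqP; rewrite subr_eq0 => /eqP.
Qed.

(** [x] and [P x] differ by a vector orthogonal to [W], hence to [U]. *)
Lemma orthoproj_proj (U : set H) x : closed_subspace U -> U `<=` W ->
  orthoproj dot U (P x) = orthoproj dot U x.
Proof.
move=> Ucl UW; have [_ WP] := projP x.
have [Ux xU] := orthoprojP dot_norm Ucl (P x).
apply/esym/orthoproj_unique => // z Uz.
by rewrite -(subrKA (P x)) linearDl /= xU// WP ?addr0//; exact: UW.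
Qed.

End ObliqueProjection.

Section MixedOperator.
Context (I : countType) (Wi Vi : I -> set H) (w v : I -> R).
Context (Q : (I -> H) -> I -> H).
Hypothesis W_bessel : fusion_bessel dot W Wi w.
Hypothesis V_bessel : fusion_bessel dot V Vi v.
Hypothesis Q_bounded : hsum_bounded_op Wi Vi Q.
Local Notation L := (mixed_op dot Wi w v Q).
Local Notation P := (Defs.proj V (orthocomp dot W)).

Let Wi_hsum x : hsum Wi (analysis dot Wi w x).
Proof. exact: (analysis_hsum dot_norm W_closed W_bessel). Qed.

Let Q_hsum x : hsum Vi (Q (analysis dot Wi w x)).
Proof. by case: Q_bounded => h _ _; exact/h/Wi_hsum. Qed.

Lemma mixed_op_mem x : V (L x).
Proof. exact: (synthesis_mem dot_norm V_closed V_bessel). Qed.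

Lemma mixed_op_linear (c : K) x y : L (c *: x + y) = c *: L x + L y.
Proof.
apply: (synthesis_linear dot_norm V_closed V_bessel) => // i.
rewrite (analysis_linear dot_norm W_closed W_bessel).
by case: Q_bounded => _ -> //; exact: Wi_hsum.
Qed.

Let mixed_op0 : L 0 = 0.
Proof.
by have := mixed_op_linear (-1) 0 0; rewrite scaler0 addr0 scaleN1r addNr.
Qed.

Lemma mixed_op_proj x : direct_sum V (orthocomp dot W) -> L (P x) = L x.
Proof.
move=> VW_sum; rewrite /mixed_op !(analysisE dot_norm W_closed W_bessel).
congr (synthesis v (Q _)); apply/funext => i.
have [/(_ i)[Wicl WiW] _ _] := W_bessel.
by rewrite orthoproj_proj.
Qed.

Lemma opnorm_proj_near_identity eps : direct_sum V (orthocomp dot W) ->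
  (opnorm (fun x => L x - P x)%R <= eps%:E)%E ->
  forall x, V x -> N (L x - x) <= eps * N x.
Proof.
move=> VW_sum Leps x Vx; have [->|x0] := eqVneq x 0.
  by rewrite mixed_op0 subr0 hnorm0 mulr0.
have n0 : 0 < N x by rewrite lt_neqAle eq_sym hnorm_eq0 x0 hnorm_ge0.
pose c := of_real s (N x)^-1; pose y := c *: x.
have Vy : V y by exact: subspaceZ.
have : ((N (L y - P y))%:E <= eps%:E)%E.
  apply: le_trans Leps; apply: ereal_sup_ubound; exists y => //=.
  by rewrite hnormZr ger0_norm ?invr_ge0 ?hnorm_ge0// mulVf ?gt_eqF.
rewrite lee_fin proj_id//.
have -> : L y = c *: L x.
  by have := mixed_op_linear c x 0; rewrite mixed_op0 !addr0.
rewrite /y -scalerBr hnormZr ger0_norm ?invr_ge0 ?hnorm_ge0//.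
by rewrite ler_pdivrMl// mulrC.
Qed.

(** A Bessel sequence with a dual is a frame: bounding
    [|x|^2 = <T_V Q T_W^* x, x>] by [|Q T_W^* x| |T_V^* x|] and then by a
    multiple of [|x| |T_V^* x|] gives the lower bound. *)
Lemma dual_bessel_frame : (forall x, V x -> L x = x) ->
  fusion_frame dot V Vi v.
Proof.
move=> Lid; have [Vsub vw [b b0 Vb]] := V_bessel.
have [bw bw0 Wb] := analysis_bounded dot_norm W_closed W_bessel.
have [_ _ [C QC]] := Q_bounded.
(* the summand 1 keeps D positive, the constant C being arbitrary *)
pose D := C ^+ 2 * bw + 1.
have D0 : 0 < D by rewrite ltr_wpDl// mulr_ge0 ?sqr_ge0// ltW.
split => //; exists (Num.min D^-1 b), b; split.
- by rewrite lt_min b0 invr_gt0 D0.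
- by rewrite ge_min lexx orbT.
move=> x Vx; split; last exact: Vb.
have xfin : frame_sum dot Vi v x \is a fin_num.
  by rewrite ge0_fin_numE ?frame_sum_ge0 ?(frame_sum_lty V_bessel).
rewrite -(fineK xfin) lee_fin; set F := fine _.
have F0 : 0 <= F by rewrite fine_ge0 ?frame_sum_ge0.
suff h : N x ^+ 2 <= D * F.
  apply: (@le_trans _ _ (D^-1 * N x ^+ 2)).
    by rewrite ler_wpM2r ?sqr_ge0// ge_min lexx.
  by rewrite ler_pdivrMl.
have := rdot_synthesis dot_norm V_closed V_bessel (Q_hsum x) Vx.
rewrite -[synthesis _ _]/(L x) Lid// rdotxx// -/F => h1.
have : hsum_norm (Q (analysis dot Wi w x)) ^+ 2 <= D * N x ^+ 2.
  have := QC _ (Wi_hsum x).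
  have := sqrtr_ge0 (fine (sqsum (Q (analysis dot Wi w x)))).
  rewrite -/(hsum_norm _); set q := hsum_norm _; set p := hsum_norm _ => q0 qp.
  have := Wb x; rewrite -/p => pn.
  apply: (@le_trans _ _ ((C * p) ^+ 2)).
    by rewrite ler_sqr ?nnegrE// (le_trans q0).
  rewrite exprMn; apply: (@le_trans _ _ (C ^+ 2 * (bw * N x ^+ 2))).
    by rewrite ler_wpM2l ?sqr_ge0.
  by rewrite mulrA ler_wpM2r ?sqr_ge0// lerDl.
move=> /(ler_wpM2r F0)/(le_trans h1).
have [->|n0] := eqVneq (N x ^+ 2) 0; first by rewrite mulr_ge0// ltW.
rewrite mulrAC [_ ^+ 2 ^+ 2]expr2 ler_pM2r//.
by rewrite lt_neqAle eq_sym n0 sqr_ge0.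
Qed.

End MixedOperator.
End Duality.

Lemma hsum_bounded_op_comp (R : realType) (s : scalar_kind)
    (H : completeNormedModType (scalars R s)) (I : countType)
    (Wi Vi Ui : I -> set H) (S Q : (I -> H) -> I -> H) :
  hsum_bounded_op Wi Vi Q -> hsum_bounded_op Vi Ui S ->
  hsum_bounded_op Wi Ui (S \o Q).
Proof.
move=> [QV Qlin [C QC]] [SU Slin [D SD]]; split => [f /QV/SU//|a f g Wf Wg|].
  by rewrite /= Qlin// Slin//; exact: QV.
(* D may be negative, and is then not monotone as a factor *)
exists (`|D| * C) => f Wf /=; apply: le_trans (SD _ (QV _ Wf)) _.
apply: (@le_trans _ _ (`|D| * hsum_norm (Q f))).
  by rewrite ler_wpM2r ?sqrtr_ge0// ler_norm.
by rewrite -mulrA ler_wpM2l// QC.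
Qed.

Theorem theorem3p8 (R : realType) (s : scalar_kind)
    (H : completeNormedModType (scalars R s))
    (dot : {dot H for @scalar_conj R s})
    (dot_norm : forall x : H, dot x x = `|x| ^+ 2)
    (H_separable : separable_space H)
    (I : countType) (V W : set H)
    (V_closed : closed_subspace V) (W_closed : closed_subspace W)
    (VW_sum : direct_sum V (orthocomp dot W))
    (Wi : I -> set H) (w : I -> R) (W_frame : fusion_frame dot W Wi w)
    (Vi : I -> set H) (v : I -> R) (V_frame : fusion_frame dot V Vi v)
    (Q : (I -> H) -> I -> H) (Q_bounded : hsum_bounded_op Wi Vi Q)
    (eps : R) (VW_dual : approx_oblique_dual dot eps Q V Vi v W Wi w)
    (eps_lt1 : eps < 1) :
  let L := mixed_op dot Wi w v Q in
  (exists A, bounded_op (@hnorm R s H) (@hnorm R s H) V V A /\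
             inverse_on V L A) /\
  (forall (A : H -> H) (vt : I -> R),
     inverse_on V L A ->
     weights vt ->
     let AVi := fun i => A @` Vi i in
     let QA := component_op (A \o @synthesis R s H I v) vt in
     fusion_bessel dot V AVi vt ->
     hsum_bounded_op Vi AVi QA ->
     oblique_dual dot (QA \o Q) V AVi vt W Wi w).
Proof.
move=> L.
have W_bessel := fusion_frame_bessel W_frame.
have V_bessel := fusion_frame_bessel V_frame.
have [eps_ge0 _ _ _ Leps] := VW_dual.
have L_mem x : V x -> V (L x).
  move=> _.
  exact: (mixed_op_mem dot_norm V_closed W_closed W_bessel V_bessel).
have L_linear c x y : V x -> V y -> L (c *: x + y) = c *: L x + L y.
  move=> _ _; exact: (mixed_op_linear dot_norm V_closed W_closed W_bessel
    V_bessel Q_bounded).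
have L_near := opnorm_proj_near_identity dot_norm V_closed W_closed W_bessel
  V_bessel Q_bounded VW_sum Leps.
split; first exact: (near_identity_inverse V_closed L_mem L_linear L_near).
move=> A vt A_inv [vt_gt0 _] AVi QA AV_bessel QA_bounded.
have A_bounded :=
  near_identity_inverse_bounded V_closed L_linear L_near eps_lt1 A_inv.
have QAQ_bounded := hsum_bounded_op_comp Q_bounded QA_bounded.
have dual x :
    mixed_op dot Wi w vt (QA \o Q) x = Defs.proj V (orthocomp dot W) x.
  have [VP _] := projP VW_sum x.
  have vt_neq0 i : vt i != 0 by rewrite gt_eqF.
  have QTx : hsum Vi (Q (analysis dot Wi w x)).
    case: Q_bounded => QV _ _; apply: QV.
    exact: (analysis_hsum dot_norm W_closed W_bessel).
  rewrite /mixed_op /=.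
  rewrite (synthesis_image dot_norm V_closed V_bessel A_bounded vt_neq0 QTx).
  rewrite -[synthesis _ _]/(mixed_op dot Wi w v Q x).
  rewrite -(mixed_op_proj dot_norm W_closed v Q W_bessel x VW_sum).
  by case: A_inv => _ _ ->.
split => //.
- apply: (dual_bessel_frame dot_norm V_closed W_closed W_bessel AV_bessel
    QAQ_bounded) => x Vx.
  by rewrite dual (proj_id V_closed VW_sum).
- apply: ge_ereal_sup => _ [x _ <-].
  by rewrite dual subrr hnorm0.
Qed.
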